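(* Let $G$ be a countable discrete amenable group, let $\pi:\mathbf{X}\to\mathbf{Y}$ and $\pi':\mathbf{X}'\to\mathbf{Y}'$ be extensions of measure-preserving $G$-systems, and suppose that there are an isomorphism $\bar\phi:\mathbf{X}\to\mathbf{X}'$ and a factor map $\phi:\mathbf{Y}\to\mathbf{Y}'$ such that $\pi'\circ\bar\phi=\phi\circ\pi$ almost everywhere. Then $$h_{\mathrm{slow}}^{U,(F_n)}(\mathbf{X}\,|\,\pi)\ \le\ h_{\mathrm{slow}}^{U,(F_n)}(\mathbf{X}'\,|\,\pi')$$ for every rate function $U$ and every F\o lner sequence $(F_n)$ for $G$.
   Context: A (left) F\o lner sequence for $G$ is a sequence of finite nonempty sets $F_n\subseteq G$ with $|gF_n\cap F_n|/|F_n|\to 1$ for each $g\in G$. A system $\mathbf{X}=(X,\mathcal{B}_X,\mu,T)$ is a measure-preserving action $T=(T^g)_{g\in G}$ (with $T^{gh}=T^gT^h$) on a standard probability space. A factor map (equivalently, an extension) $\pi:\mathbf{X}\to\mathbf{Y}=(Y,\mathcal{B}_Y,\nu,S)$ is a measurable map with $\pi_*\mu=\nu$ and $\pi T^g=S^g\pi$ a.e.; an isomorphism is a factor map invertible modulo null sets. For an extension $\pi$, $\mu=\int\mu_y\,d\nu(y)$ denotes the disintegration of $\mu$ over $\pi$. All partitions are finite and measurable. For $P=\{P_0,\dots,P_{r-1}\}$, $P(x)$ is the index $i$ with $x\in P_i$. For finite $F\subseteq G$, $d_{P,F}(x,x')=\frac1{|F|}\sum_{f\in F}1_{P(T^fx)\ne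 P(T^fx')}$, and $\operatorname{diam}_{P,F}$ is the diameter with respect to this pseudo-metric. For a probability measure $\lambda$ on $X$ and $\epsilon>0$, $\operatorname{cov}(\lambda,P,F,\epsilon)$ is the smallest $M$ such that there exist $E_1,\dots,E_M\subseteq X$ with $\operatorname{diam}_{P,F}(E_i)\le\epsilon$ for all $i$ and $\lambda(\bigcup E_i)\ge1-\epsilon$. The relative covering number is $$\operatorname{cov}(\mu,P,F,\epsilon\,|\,\pi)=\inf_{S'\subseteq Y:\ \nu(S')\ge1-\epsilon}\ \sup_{y\in S'}\operatorname{cov}(\mu_y,P,F,\epsilon).$$ A rate function is an increasing function $U:\mathbb{N}\to(0,\infty)$ with $U(n)\to\infty$. The relative slow entropy is $$h_{\mathrm{slow}}^{U,(F_n)}(\mathbf{X},P\,|\,\pi)=\sup_{\epsilon>0}\limsup_{n\to\infty}\frac{\operatorname{cov}(\mu,P,F_n,\epsilon\,|\,\pi)}{U(|F_n|)},\qquad h_{\mathrm{slow}}^{U,(F_n)}(\mathbf{X}\,|\,\pi)=\sup_P h_{\mathrm{slow}}^{U,(F_n)}(\mathbf{X},P\,|\,\pi),$$ with values in $[0,\infty]$, the last supremum being over all partitions $P$ of $X$. *)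

(* Defs.v *)
From HB Require Import structures.
From mathcomp Require Import all_boot all_order all_algebra finmap.
From mathcomp Require Import all_classical all_reals all_analysis.

Set Implicit Arguments.
Unset Strict Implicit.
Unset Printing Implicit Defensive.
Import Order.TTheory GRing.Theory Num.Theory.
Import numFieldNormedType.Exports.
Local Open Scope classical_set_scope.
Local Open Scope ring_scope.

Section Groups.
Variables (R : realType) (G : groupType).

Definition folner_seq (F : nat -> {fset G}) : Prop :=
  (forall n, F n != fset0) /\
  (forall g : G,
    (fun n => (#|` ([fset (g * f)%g | f in F n] `&` F n)%fset |)%:R
              / (#|` F n|)%:R : R) @ \oo --> (1 : R)).

(* For countable discrete groups, amenability is the existence of a Folner
   sequence. *)
Definition amenable : Prop := exists F, folner_seq F.

End Groups.

(* The sigma-algebra of X is the Borel sigma-algebra of a Polish topology; the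
   topology is carried by a copy M of X. *)
Definition standard_borel (R : realType) d (X : measurableType d) : Prop :=
  exists (M : completePseudoMetricType R) (f : X -> M),
    [/\ hausdorff_space M,
        exists2 D : set M, countable D & dense D,
        set_bij [set: X] [set: M] f
      & forall A : set X, measurable A <-> <<s @open M >> (f @` A)].

Record gsystem (R : realType) (G : groupType) := GSystem {
  sys_disp : measure_display;
  sys_space :> measurableType sys_disp;
  sys_meas : probability sys_space R;
  sys_act : G -> sys_space -> sys_space;
  sys_standard : standard_borel R sys_space;
  sys_act1 : forall x, sys_act 1%g x = x;
  sys_actM : forall g h x, sys_act (g * h)%g x = sys_act g (sys_act h x);
  sys_act_measurable : forall g, measurable_fun [set: sys_space] (sys_act g);
  sys_act_preserving : forall g (A : set sys_space), measurable A ->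
    pushforward sys_meas (sys_act g) A = sys_meas A }.

Arguments sys_meas {R G} X : rename.
Arguments sys_act {R G X} g x : rename.

Section Systems.
Variables (R : realType) (G : groupType).
Implicit Types X Y : gsystem R G.

Definition factor_map X Y (pi : X -> Y) : Prop :=
  [/\ measurable_fun [set: X] pi,
      forall B : set Y, measurable B ->
        pushforward (sys_meas X) pi B = sys_meas Y B
    & forall g, {ae sys_meas X, forall x,
        pi (sys_act g x) = sys_act g (pi x)}].

Definition system_iso X Y (phi : X -> Y) : Prop :=
  factor_map phi /\
  exists psi : Y -> X,
    [/\ measurable_fun [set: Y] psi,
        {ae sys_meas X, forall x, psi (phi x) = x}
      & {ae sys_meas Y, forall y, phi (psi y) = y}].

(* A disintegration mu = \int mu_y d nu(y) of mu over pi, with mu_y := k y: a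
   measurable family of probability measures, almost every mu_y being carried
   by the fibre of y. It is unique up to a nu-null set of y. *)
Definition disintegration X Y (pi : X -> Y) (k : R.-pker Y ~> X) : Prop :=
  {ae sys_meas Y, forall y, k y (pi @^-1` [set y]) = 1%E} /\
  (forall A : set X, measurable A ->
    sys_meas X A = \int[sys_meas Y]_(y in [set: Y]) k y A)%E.

End Systems.

(* A finite measurable partition {P_0, ..., P_{r-1}}; cells may be empty. *)
Record fin_partition d (X : measurableType d) := FinPartition {
  fp_size : nat;
  fp_cell :> 'I_fp_size -> set X;
  fp_measurable : forall i, measurable (fp_cell i);
  fp_trivIset : trivIset [set: 'I_fp_size] fp_cell;
  fp_cover : cover [set: 'I_fp_size] fp_cell = [set: X] }.

(* P(x), in the form Some i for the unique i with x in P_i; it is never None. *)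
Definition fp_index d (X : measurableType d) (P : fin_partition X) (x : X) :
  option 'I_(fp_size P) := [pick i | x \in P i].

Definition rate_function (R : realType) (U : nat -> R) : Prop :=
  [/\ forall n, 0 < U n,
      {homo U : m n / (m <= n)%N >-> m <= n}
    & U @ \oo --> +oo].

Section SlowEntropy.
Variables (R : realType) (G : groupType) (X : gsystem R G).
Variables (P : fin_partition X).

Definition hamming (F : {fset G}) (x x' : X) : R :=
  (#|` F|)%:R^-1 *
  \sum_(f <- F) (fp_index P (sys_act f x) != fp_index P (sys_act f x'))%:R.

(* The values of hamming lie in [0, 1], and the real sup of set0 is 0. *)
Definition hamming_diam (F : {fset G}) (E : set X) : R :=
  sup [set hamming F x x' | x in E & x' in E].

(* Measures are only meaningful on measurable sets, hence the measurability of
   the E_i (and of S' below). *)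
Definition covers (lambda : {measure set X -> \bar R}) (F : {fset G}) (e : R)
    (M : nat) : Prop :=
  exists E : 'I_M -> set X,
    [/\ forall i, measurable (E i),
        forall i, hamming_diam F (E i) <= e
      & ((1 - e)%:E <= lambda (\bigcup_i E i))%E].

Definition cov (lambda : {measure set X -> \bar R}) (F : {fset G}) (e : R) :
  \bar R := ereal_inf [set M%:R%:E | M in covers lambda F e].

(* The supremum is taken in [0, +oo], so that it is 0 when S' is empty (which
   can only occur for e >= 1). *)
Definition relcov (Y : gsystem R G) (k : R.-pker Y ~> X) (F : {fset G})
    (e : R) : \bar R :=
  ereal_inf [set Order.max 0%E (ereal_sup [set cov (k y) F e | y in S']) |
    S' in [set S' : set Y | measurable S' /\ ((1 - e)%:E <= sys_meas Y S')%E]].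

Definition slow_entropy_part (U : nat -> R) (F : nat -> {fset G})
    (Y : gsystem R G) (k : R.-pker Y ~> X) : \bar R :=
  ereal_sup
    [set limn_esup (fun n => relcov k (F n) e * ((U (#|` F n|))^-1)%:E)%E |
      e in [set e : R | 0 < e]].

End SlowEntropy.

(* The relative slow entropy of X over pi depends on pi only through a
   disintegration k of the measure of X over pi. *)
Definition slow_entropy (R : realType) (G : groupType) (U : nat -> R)
    (F : nat -> {fset G}) (X Y : gsystem R G) (k : R.-pker Y ~> X) : \bar R :=
  ereal_sup [set slow_entropy_part P U F k | P in [set: fin_partition X]].

(* Main.v *)
Require Import Defs.
From HB Require Import structures.
From mathcomp Require Import all_boot all_order all_algebra finmap.
From mathcomp Require Import all_classical all_reals all_analysis.
From mathcomp Require Import measurable_realfun ring lra.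
Set Implicit Arguments.
Unset Strict Implicit.
Unset Printing Implicit Defensive.
Import Order.TTheory GRing.Theory Num.Theory.
Import numFieldNormedType.Exports.
Local Open Scope classical_set_scope.
Local Open Scope ring_scope.

(** Refining the base of an extension can only make the fibre measures easier to
    cover. Through the isomorphism, X and X' are the same system, and the fibre
    of X' over y' is the union of the fibres of X over the points y with
    phi y = y'; the measure mu'_(y') is an average of the measures mu_y. A
    family of sets that covers all but e' of mu'_(y') therefore covers all but
    e of mu_y for all but a small proportion of these y, when e' is small
    compared with e^2.

    To avoid disintegrating the measure of Y over Y', the covers are glued into
    one set. The Hamming pseudo-metric of (P, F) depends only on the P-names of
    points along F, which form a finite set, so a cover may be replaced by a
    set A of names ([covers_name], [name_covers]), and there are finitely many
    candidates for A. One can thus choose measurably, for y' in Y', a set of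
    names a y' which is covered by few small sets and carries most of
    mu'_(y') whenever the latter is possible
    ([measurable_cover_selection]). The set W' of the points x' whose name
    lies in a (pi' x') has measure close to 1, since on the fibre of y' it is
    cut out by the names in a y'. Up to a null set, its preimage in X is the set
    W of the points whose name for the pulled back partition lies in
    a (phi (pi x)). As W has measure close to 1, Markov's inequality
    ([disintegration_lower]) makes mu_y W close to 1 for most y; on the fibre
    of y, W is cut out by the names in a (phi y), so this set of names covers
    most of mu_y ([relcov_le_base_factor]).

    The comparison of relative covering numbers holds for each finite F, each
    partition P of X and the corresponding partition of X', so it passes to the
    upper limit and to the suprema that define slow entropy. *)

(** * Measurability of maps with finitely many values *)

Section FiniteValued.
Context {d} {T : measurableType d}.

Definition discrete_measurable (V : Type) (g : T -> V) :=
  forall B : set V, measurable (g @^-1` B).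

Lemma discrete_measurable_fin (V : finType) (g : T -> V) :
  (forall v, measurable (g @^-1` [set v])) -> discrete_measurable g.
Proof.
move=> mg B.
have -> : g @^-1` B = \bigcup_(v in B) (g @^-1` [set v]).
  by apply/seteqP; split => [x Bx|x [v Bv] /= -> //]; exists (g x).
by apply: fin_bigcup_measurable => //; exact: finite_finset.
Qed.

Lemma discrete_measurable_ffun (I V : finType) (g : I -> T -> V) :
  (forall i, discrete_measurable (g i)) ->
  discrete_measurable (fun x => [ffun i => g i x]).
Proof.
move=> mg; apply: discrete_measurable_fin => v.
have -> : (fun x => [ffun i => g i x]) @^-1` [set v] =
    \bigcap_(i in [set: I]) (g i @^-1` [set v i]).
  apply/seteqP; split => [x /= <- i _|x gx]; first by rewrite /= ffunE.
  by apply/ffunP => i; rewrite ffunE; exact: gx.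
by apply: fin_bigcap_measurable => [|i _]; [exact: finite_finset|exact: mg].
Qed.

Lemma discrete_measurable_pair (V W : finType) (g : T -> V) (h : T -> W) :
  discrete_measurable g -> discrete_measurable h ->
  discrete_measurable (fun x => (g x, h x)).
Proof.
move=> mg mh; apply: discrete_measurable_fin => -[v w].
have -> : (fun x => (g x, h x)) @^-1` [set (v, w)] =
    g @^-1` [set v] `&` h @^-1` [set w].
  by apply/seteqP; split => x /= [-> ->].
exact: measurableI.
Qed.

Lemma measurable_in_random_set (V : finType) (g : T -> V) (h : T -> {set V}) :
  discrete_measurable g -> discrete_measurable h ->
  measurable [set x | g x \in h x].
Proof.
move=> mg mh.
exact: (discrete_measurable_pair mg mh) [set uA : V * {set V} | uA.1 \in uA.2].
Qed.

Lemma discrete_measurable_bool (b : T -> bool) :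
  measurable [set x | b x] -> discrete_measurable b.
Proof.
move=> mb; apply: discrete_measurable_fin => -[]; first exact: mb.
have -> : b @^-1` [set false] = ~` [set x | b x].
  by apply/seteqP; split => x /=; case: (b x).
exact: measurableC.
Qed.

End FiniteValued.

Lemma discrete_measurable_comp d d' (T : measurableType d)
    (T' : measurableType d') (V : Type) (p : T -> T') (g : T' -> V) :
  measurable_fun [set: T] p -> discrete_measurable g ->
  discrete_measurable (g \o p).
Proof.
move=> mp mg B; rewrite -[X in measurable X]setTI.
exact: (mp measurableT _ (mg B)).
Qed.

(** * Almost everywhere statements *)

Section AlmostEverywhere.
Context {R : realType} {d} {T : measurableType d}.
Context (m : {measure set T -> \bar R}).

Lemma ae_measure_le (A B : set T) : measurable A -> measurable B ->
  {ae m, forall x, A x -> B x} -> (m A <= m B)%E.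
Proof.
move=> mA mB [N [mN N0 hN]].
have AB : A `<=` B `|` N.
  move=> x Ax; have [Bx|nBx] := pselect (B x); [by left|right].
  by apply: hN => /= /(_ Ax).
apply: (@le_trans _ _ (m (B `|` N))).
  by apply: le_measure => //; rewrite inE //; exact: measurableU.
by rewrite -[leRHS]adde0 -N0; apply: measureU2.
Qed.

Lemma ae_preserving d' (T' : measurableType d') (m' : {measure set T' -> \bar R})
    (p : T -> T') (Q : set T') : measurable_fun [set: T] p ->
  (forall B, measurable B -> m (p @^-1` B) = m' B) ->
  {ae m', forall x, Q x} -> {ae m, forall x, Q (p x)}.
Proof.
move=> mp pm [N [mN N0 hN]]; exists (p @^-1` N); split.
- by rewrite -[X in measurable X]setTI; exact: mp.
- by rewrite pm.
- by move=> x /= nQ; apply: hN.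
Qed.

End AlmostEverywhere.

(** * Disintegrations *)

Section Disintegration.
Context {R : realType} {G : groupType} {X Y : gsystem R G}.
Context (pi : X -> Y) (mpi : measurable_fun [set: X] pi).
Context (k : R.-pker Y ~> X) (dis : disintegration pi k).

(** Points are closed in the Polish topology that generates the sigma-algebra. *)
Lemma measurable_point (y : Y) : measurable [set y].
Proof.
have [M [f [hM _ [_ fi _] mE]]] := sys_standard Y.
apply/mE; rewrite image_set1.
rewrite -[X in <<s _ >> X]setCK -setTD; apply: sigma_algebraCD.
apply: sub_sigma_algebra; apply: closed_openC.
by apply: accessible_closed_set1; exact: hausdorff_accessible.
Qed.

Lemma kernelT (y : Y) : k y [set: X] = 1%E.
Proof. exact: prob_kernel. Qed.

Lemma kernel_le1 (y : Y) (A : set X) : measurable A -> (k y A <= 1)%E.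
Proof.
move=> mA; rewrite -(kernelT y).
by apply: le_measure => //; rewrite inE.
Qed.

Lemma kernel_setC (y : Y) (A : set X) : measurable A ->
  (k y A + k y (~` A) = 1)%E.
Proof.
move=> mA; rewrite -(kernelT y) -(setUv A) measureU ?setICr//.
exact: measurableC.
Qed.

(** A measure carried by the fibre of y does not see what happens outside it. *)
Lemma kernel_fibre_le (y : Y) (A B : set X) :
  k y (pi @^-1` [set y]) = 1%E -> measurable A -> measurable B ->
  (forall x, pi x = y -> A x -> B x) -> (k y A <= k y B)%E.
Proof.
move=> ky mA mB AB.
have mf : measurable (pi @^-1` [set y]).
  by rewrite -[X in measurable X]setTI; apply: mpi => //; exact: measurable_point.
have f0 : k y (~` (pi @^-1` [set y])) = 0%E.
  have := kernel_setC y mf; rewrite ky => e.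
  have : (1 + k y (~` (pi @^-1` [set y])) - 1 = 1 - 1 :> \bar R)%E by rewrite e.
  by rewrite addeAC subee // add0e.
apply: ae_measure_le => //; exists (~` (pi @^-1` [set y])); split => //.
  exact: measurableC.
by move=> x /= nAB pxy; apply: nAB; exact: AB.
Qed.

Lemma measurable_kernel_ge (A : set X) (c : \bar R) : measurable A ->
  measurable [set y | (c <= k y A)%E].
Proof.
move=> mA; rewrite -[X in measurable X]setTI.
by apply: emeasurable_fun_c_infty => //; exact: measurable_kernel.
Qed.

(** Markov's inequality for y |-> k y A, whose integral is the measure of A. *)
Lemma disintegration_markov (A : set X) (c : R) : 0 <= c -> measurable A ->
  (c%:E * sys_meas Y [set y | (c%:E <= k y A)%E] <= sys_meas X A)%E.
Proof.
move=> c0 mA; have mS := measurable_kernel_ge c%:E mA.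
rewrite dis.2 // -integral_cst //.
apply: (@le_trans _ _
  (\int[sys_meas Y]_(y in [set y | (c%:E <= k y A)%E]) k y A)%E).
  apply: ge0_le_integral => //.
  by apply: measurable_funTS; exact: measurable_kernel.
by apply: ge0_subset_integral => //; exact: measurable_kernel.
Qed.

(** Markov's inequality for the complement of A: its measure is at most e^2, so
    its fibre measures exceed e on a set of measure at most e. *)
Lemma disintegration_lower (A : set X) (e : R) : 0 < e -> measurable A ->
  ((1 - e ^+ 2)%:E <= sys_meas X A)%E ->
  exists S : set Y, [/\ measurable S, ((1 - e)%:E <= sys_meas Y S)%E
    & forall y, S y -> ((1 - e)%:E <= k y A)%E].
Proof.
move=> e0 mA muA; have mAC := measurableC mA.
pose B := [set y | (e%:E <= k y (~` A))%E].
have mB : measurable B by exact: measurable_kernel_ge.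
exists (~` B); split; first exact: measurableC.
  rewrite probability_setC // EFinB leeD2l // leeN2.
  have : (e%:E * sys_meas Y B <= (e * e)%:E)%E.
    apply: (le_trans (disintegration_markov (ltW e0) mAC)).
    rewrite probability_setC // leeBlDr ?fin_num_measure //.
    rewrite -leeBlDl // -EFinB //.
  by rewrite EFinM lee_pmul2l.
move=> y /= /negP; rewrite -ltNge => kyA.
have := kernel_setC y mA.
have kf : k y A \is a fin_num.
  by rewrite ge0_fin_numE // (le_lt_trans (kernel_le1 _ mA)) // ltry.
move: kyA; have : k y (~` A) \is a fin_num.
  by rewrite ge0_fin_numE // (le_lt_trans (kernel_le1 _ mAC)) // ltry.
move: kf; move: (k y A) (k y (~` A)) => [a||] [b||] //= _ _.
rewrite lte_fin => be; rewrite -EFinD => -[ab]; rewrite lee_fin; lra.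
Qed.

End Disintegration.

(** * Names of points *)

Section Names.
Context {R : realType} {G : groupType} {X : gsystem R G}.
Context (P : fin_partition X) (F : {fset G}).

Lemma fp_index_Some (x : X) (i : 'I_(fp_size P)) :
  fp_index P x = Some i <-> P i x.
Proof.
rewrite /fp_index; split.
  by case: pickP => // j /set_mem Pj [<-].
move=> Pi; case: pickP => [j /set_mem Pj|/(_ i)]; last by rewrite mem_set.
by congr Some; apply: (@fp_trivIset _ _ P) => //; exists x.
Qed.

Lemma fp_index_neq_None (x : X) : fp_index P x <> None.
Proof.
have : [set: X] x by [].
rewrite -(fp_cover P) => -[i _ /fp_index_Some ->].
by [].
Qed.

Lemma discrete_measurable_fp_index : discrete_measurable (fp_index P).
Proof.
apply: discrete_measurable_fin => -[i|].
  have -> : fp_index P @^-1` [set Some i] = P i.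
    by apply/seteqP; split => x /fp_index_Some.
  exact: fp_measurable.
have -> : fp_index P @^-1` [set None] = set0; last exact: measurable0.
by apply/seteqP; split => // x /fp_index_neq_None.
Qed.

(** What is known as the P-name of x along F. *)
Definition name (x : X) : {ffun F -> option 'I_(fp_size P)} :=
  [ffun f : F => fp_index P (sys_act (val f) x)].

Lemma discrete_measurable_name : discrete_measurable name.
Proof.
apply: discrete_measurable_ffun => f.
apply: (@discrete_measurable_comp _ _ _ _ _ (sys_act (val f)) (fp_index P)).
  exact: sys_act_measurable.
exact: discrete_measurable_fp_index.
Qed.

End Names.

Section NameDistance.
Context {R : realType} {G : groupType} {V : finType} (F : {fset G}).
Local Notation word := {ffun F -> V}.

Definition word_dist (u v : word) : R :=
  (#|` F|)%:R^-1 * \sum_(f : F) (u f != v f)%:R.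

(** This is the covering condition on words: since there are only finitely many
    sets A of words, a measurable choice among them is possible, contrary to
    covers by arbitrary measurable subsets of the system. *)
Definition small_cover (e : R) (M : nat) (A : {set word}) : Prop :=
  exists E : 'I_M -> {set word},
    (forall u, u \in A -> exists i, u \in E i) /\
    (forall i u v, u \in E i -> v \in E i -> word_dist u v <= e).

Lemma small_cover_le (e e' : R) (M : nat) (A : {set word}) :
  e <= e' -> small_cover e M A -> small_cover e' M A.
Proof.
move=> ee' [E [AE dE]]; exists E; split => // i u v ui vi.
by apply: le_trans ee'; exact: dE ui vi.
Qed.

Lemma small_cover0 (e : R) : small_cover e 0 finset.set0.
Proof.
by exists (fun _ => finset.set0); split => [u|[]//]; rewrite finset.in_set0.
Qed.

End NameDistance.

(** * Covering numbers in terms of names *)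

Section Covers.
Context {R : realType} {G : groupType} {X : gsystem R G}.
Context (P : fin_partition X) (F : {fset G}).

Lemma hamming_name (x x' : X) :
  hamming P F x x' = word_dist (name P F x) (name P F x').
Proof.
rewrite /hamming /word_dist big_seq_fsetE /=; congr (_ * _).
by apply: eq_bigr => f _; rewrite !ffunE.
Qed.

(** The Hamming pseudo-metric is bounded, so that its supremum over any set is
    a genuine upper bound. *)
Lemma hamming_le_diam (E : set X) (x x' : X) :
  E x -> E x' -> hamming P F x x' <= hamming_diam P F E.
Proof.
move=> Ex Ex'; apply: ub_le_sup; last by exists x => //; exists x'.
exists ((#|` F|)%:R^-1 * \sum_(f <- F) 1) => _ [z _ [z' _ <-]].
rewrite /hamming ler_wpM2l ?invr_ge0 //.
by apply: ler_sum => f _; case: (_ != _).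
Qed.

Lemma hamming_diam_le (E : set X) (e : R) : 0 <= e ->
  (forall x x', E x -> E x' -> hamming P F x x' <= e) ->
  hamming_diam P F E <= e.
Proof.
move=> e0 dE; rewrite /hamming_diam.
have [->|/set0P E0] := eqVneq [set hamming P F x x' | x in E & x' in E] set0.
  by rewrite sup0.
by apply: ge_sup => // _ [x Ex [x' Ex' <-]]; exact: dE.
Qed.

Context (lambda : {measure set X -> \bar R}) (e : R).

(** Replacing each set of a cover by the union of the name classes that it meets
    enlarges it without changing its diameter. *)
Lemma covers_name (M : nat) : covers P lambda F e M ->
  exists A, small_cover e M A /\
    ((1 - e)%:E <= lambda (name P F @^-1` [set` A]))%E.
Proof.
move=> [E [mE dE lE]].
pose N i := [set u : {ffun F -> option 'I_(fp_size P)} |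
  `[< exists2 x, E i x & name P F x = u >]]%SET.
exists (\bigcup_i N i)%SET; split.
  exists N; split => [u /bigcupP[i _ ui]|i u v]; first by exists i.
  rewrite !inE => -[x Ex <-] [y Ey <-].
  rewrite -hamming_name.
  by apply: le_trans (dE i); exact: hamming_le_diam.
apply: (le_trans lE); apply: le_measure.
- by rewrite inE; apply: fin_bigcup_measurable => //; exact: finite_finset.
- by rewrite inE; exact: discrete_measurable_name.
- move=> x [i _ Ex]; apply/(@finset.bigcupP _ _ (name P F x)); exists i => //.
  by rewrite !inE; exists x.
Qed.

Lemma name_covers (M : nat) (A : {set {ffun F -> option 'I_(fp_size P)}}) :
  0 <= e -> small_cover e M A ->
  ((1 - e)%:E <= lambda (name P F @^-1` [set` A]))%E -> covers P lambda F e M.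
Proof.
move=> e0 [E [AE dE]] lA.
have mE (B : set _) : measurable (name P F @^-1` B).
  exact: discrete_measurable_name.
exists (fun i => name P F @^-1` [set` E i]); split=> // [i|].
  by apply: hamming_diam_le => // x y ? ?; rewrite hamming_name; apply: (dE i).
apply: (le_trans lA); apply: le_measure; rewrite ?inE //.
  by apply: fin_bigcup_measurable => //; exact: finite_finset.
by move=> x /= /AE[i xi]; exists i.
Qed.

(** The infimum of a nonempty set of natural numbers is attained. *)
Lemma cov_attained : (cov P lambda F e < +oo)%E ->
  exists2 M, covers P lambda F e M & (M%:R%:E <= cov P lambda F e)%E.
Proof.
move=> cfin.
have [M0 hM0] : exists M, `[< covers P lambda F e M >].
  by have /ereal_inf_ltP[_ [M hM _] _] := cfin; exists M; exact/asboolP.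
have exM : exists M, `[< covers P lambda F e M >] by exists M0.
case: (ex_minnP exM) => M /asboolP hM minM; exists M => //.
by apply: le_ereal_inf_tmp => _ [N /asboolP hN <-]; rewrite lee_fin ler_nat minM.
Qed.

End Covers.

(** * Measurable choice of covers *)

Section Selection.
Context {R : realType} {G : groupType} {X Y : gsystem R G}.
Context (k : R.-pker Y ~> X) (P : fin_partition X) (F : {fset G}).
Local Notation word := {ffun F -> option 'I_(fp_size P)}.

(** For each y, a y is the first set of names, in a fixed enumeration, among
    those that have a small cover by at most c sets and carry 1 - e of k y. It
    depends only on which of the finitely many sets of names qualify, and each
    set A qualifies for a measurable set of y, because y |-> k y (name^-1 A) is
    measurable. *)
Lemma measurable_cover_selection (e : R) (c : \bar R) (S : set Y) :
  (0 <= c < +oo)%E -> (forall y, S y -> (cov P (k y) F e <= c)%E) ->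
  exists a : Y -> {set word}, [/\ discrete_measurable a,
    forall y, exists2 M, (M%:R%:E <= c)%E & small_cover e M (a y)
    & forall y, S y -> ((1 - e)%:E <= k y (name P F @^-1` [set` a y]))%E].
Proof.
move=> /andP[c0 coo] covS.
pose adm (A : {set word}) := exists2 M, (M%:R%:E <= c)%E & small_cover e M A.
pose b A y := `[< adm A >] && ((1 - e)%:E <= k y (name P F @^-1` [set` A]))%E.
(* The empty set of names serves as default: it is covered by no set at all. *)
pose first (w : {ffun {set word} -> bool}) := odflt finset.set0 [pick A | w A].
pose w y := [ffun A => b A y].
have adm_first y : adm (first (w y)).
  rewrite /first; case: pickP => [A|_] /=.
    by rewrite ffunE => /andP[/asboolP].
  by exists 0%N; [exact: c0|exact: small_cover0].
exists (first \o w); split => // [|y Sy].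
  have mw : discrete_measurable w.
    apply: discrete_measurable_ffun => A; apply: discrete_measurable_bool.
    rewrite /b; case: asboolP => _ /=; last first.
      by rewrite (_ : [set _ | _] = set0) //; apply/seteqP; split.
    by apply: measurable_kernel_ge; exact: discrete_measurable_name.
  by move=> B; exact: mw (first @^-1` B).
have [M hM Mle] := cov_attained (le_lt_trans (covS y Sy) coo).
have [A [sA lA]] := covers_name hM.
rewrite /= /first; case: pickP => [B|/(_ A)] /=.
  by rewrite ffunE => /andP[].
rewrite ffunE /b lA andbT => /asboolP[]; exists M => //.
exact: le_trans (covS y Sy).
Qed.

End Selection.

(** * Transport along an isomorphism *)

Section Transport.
Context {R : realType} {G : groupType} {X X' : gsystem R G}.

Definition pullback_partition (psi : X' -> X)
    (mpsi : measurable_fun [set: X'] psi) (P : fin_partition X) :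
  fin_partition X'.
Proof.
refine (@FinPartition _ X' (fp_size P) (fun i => psi @^-1` P i) _ _ _).
- move=> i; rewrite -[X in measurable X]setTI; apply: mpsi => //.
  exact: fp_measurable.
- by move=> i j _ _ [x [Pi Pj]]; apply: (@fp_trivIset _ _ P) => //; exists (psi x).
- apply/seteqP; split => // x _.
  have : [set: X] (psi x) by [].
  by rewrite -(fp_cover P).
Defined.

Context (phibar : X -> X') (phibar_factor : factor_map phibar).
Context (psi : X' -> X) (mpsi : measurable_fun [set: X'] psi).
Context (psiK : {ae sys_meas X, forall x, psi (phibar x) = x}).
Variables (P : fin_partition X) (F : {fset G}).

(** The name involves only the finitely many f in F, so one null set accounts
    for all of them. *)
Lemma ae_name_pullback : {ae sys_meas X, forall x,
  name (pullback_partition mpsi P) F (phibar x) = name P F x}.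
Proof.
have aeF : {ae sys_meas X, forall x, forall f : F,
    psi (sys_act (val f) (phibar x)) = sys_act (val f) x}.
  apply: filter_forall => f.
  have [_ _ /(_ (val f)) eqv] := phibar_factor.
  have K := ae_preserving (sys_act_measurable (val f))
    (@sys_act_preserving _ _ X (val f)) psiK.
  by move: eqv K; apply: filterS2 => x <-.
by apply: filterS aeF => x hx; apply/ffunP => f; rewrite !ffunE -hx.
Qed.

End Transport.

(** * Comparison of relative covering numbers *)

Section Comparison.
Context {R : realType} {G : groupType} {X Y X' Y' : gsystem R G}.
Context (pi : X -> Y) (pi_ext : factor_map pi).
Context (pi' : X' -> Y') (pi'_ext : factor_map pi').
Context (k : R.-pker Y ~> X) (kdis : disintegration pi k).
Context (k' : R.-pker Y' ~> X') (k'dis : disintegration pi' k').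
Context (phibar : X -> X') (phibar_factor : factor_map phibar).
Context (psi : X' -> X) (mpsi : measurable_fun [set: X'] psi).
Context (psiK : {ae sys_meas X, forall x, psi (phibar x) = x}).
Context (phi : Y -> Y') (phi_factor : factor_map phi).
Context (comm : {ae sys_meas X, forall x, pi' (phibar x) = phi (pi x)}).
Variables (P : fin_partition X) (F : {fset G}).
Local Notation P' := (pullback_partition mpsi P).

(** The loss from d^2 / 2 to d has two sources: the exceptional points of Y' and
    the exceptional parts of their fibres give the complement of W' measure at
    most d^2, and Markov's inequality on X then costs a square root. *)
Lemma relcov_le_base_factor (e d : R) : 0 < d -> d <= 1 -> d <= e ->
  (relcov P k F e <= relcov P' k' F (d ^+ 2 / 2))%E.
Proof.
move=> d0 d1 de; set e' := d ^+ 2 / 2.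
have e'd : e' <= d by rewrite /e'; nra.
have e'e : e' <= e by exact: le_trans de.
have [mpi _ _] := pi_ext; have [mpi' _ _] := pi'_ext.
have [mphi _ _] := phi_factor; have [mphibar presbar _] := phibar_factor.
apply: le_ereal_inf_tmp => _ [S' [mS' S'ge] <-].
set c := Order.max _ _.
have [->|cfin] := eqVneq c +oo%E; first exact: leey.
have c0 : (0 <= c)%E by rewrite /c le_max lexx.
have [a [ma acov aS']] : exists a : Y' -> {set {ffun F -> option 'I_(fp_size P)}},
    [/\ discrete_measurable a,
      forall y, exists2 M, (M%:R%:E <= c)%E & small_cover e' M (a y)
      & forall y, S' y -> ((1 - e')%:E <= k' y (name P' F @^-1` [set` a y]))%E].
  apply: (@measurable_cover_selection _ _ _ _ k' P'); first by rewrite c0 ltey.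
  move=> y S'y; rewrite /c le_max; apply/orP; right.
  by apply: ereal_sup_ubound; exists y.
pose W' := [set x' | name P' F x' \in a (pi' x')].
have mW' : measurable W'.
  apply: measurable_in_random_set; first exact: discrete_measurable_name.
  exact: discrete_measurable_comp mpi' ma.
pose W := [set x | name P F x \in a (phi (pi x))].
have mW : measurable W.
  apply: measurable_in_random_set; first exact: discrete_measurable_name.
  exact: discrete_measurable_comp mpi (discrete_measurable_comp mphi ma).
(* By the choice of a, (k' y) W' >= 1 - e' for almost all y in S', and
   (1 - e')^2 >= 1 - 2 e' = 1 - d^2. *)
have muW' : ((1 - d ^+ 2)%:E <= sys_meas X' W')%E.
  have e'1 : 0 <= 1 - e' by lra.
  apply: le_trans (disintegration_markov k'dis e'1 mW').
  apply: (@le_trans _ _ ((1 - e')%:E * (1 - e')%:E)%E).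
    by rewrite -EFinM lee_fin /e'; nra.
  apply: lee_wpmul2l; first by rewrite lee_fin.
  apply: (le_trans S'ge); apply: ae_measure_le => //.
    exact: measurable_kernel_ge.
  apply: filterS (k'dis.1) => y ky S'y /=.
  apply: (le_trans (aS' y S'y)); apply: (kernel_fibre_le mpi' ky) => //.
    exact: discrete_measurable_name.
  by move=> x <-.
have muW : ((1 - d ^+ 2)%:E <= sys_meas X W)%E.
  apply: (le_trans muW'); rewrite -(presbar _ mW').
  apply: (@ae_measure_le _ _ _ (sys_meas X) (phibar @^-1` W')) => //.
    by rewrite -[X in measurable X]setTI; exact: (mphibar measurableT _ mW').
  move: comm (ae_name_pullback phibar_factor mpsi psiK P F).
  by apply: filterS2 => x cx nx; rewrite /W' /W /= nx cx.
have [S [mS Sge SW]] := disintegration_lower kdis d0 mW muW.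
(* Outside N, the measures k y are carried by the fibres of pi. *)
have [N [mN N0 kN]] := kdis.1.
apply: (@le_trans _ _
  (Order.max 0%E (ereal_sup [set cov P (k y) F e | y in S `\` N]))).
  apply: ereal_inf_lbound; exists (S `\` N) => //; split; first exact: measurableD.
  apply: (@le_trans _ _ (1 - d)%:E); first by rewrite lee_fin; lra.
  apply: (le_trans Sge); apply: ae_measure_le => //; first exact: measurableD.
  by exists N; split => // y /= nSN; apply: contrapT => Ny; apply: nSN.
rewrite ge_max c0 /=; apply: ge_ereal_sup => _ [y [Sy Ny] <-].
have ky : k y (pi @^-1` [set y]) = 1%E by apply: contrapT => /kN.
have [M Mc sM] := acov (phi y).
apply: le_trans Mc; apply: ereal_inf_lbound; exists M => //.
apply: (@name_covers _ _ _ _ _ _ _ _ (a (phi y))).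
- by lra.
- exact: small_cover_le sM.
apply: (@le_trans _ _ (k y W)).
  by apply: (le_trans _ (SW y Sy)); rewrite lee_fin; lra.
apply: (kernel_fibre_le mpi ky) => //.
  exact: discrete_measurable_name.
by move=> x <-.
Qed.

End Comparison.

Lemma le_limn_esup (R : realType) (u v : nat -> \bar R) :
  (forall n, (u n <= v n)%E) -> (limn_esup u <= limn_esup v)%E.
Proof.
move=> uv; apply: le_ereal_inf_tmp => _ [A FA <-].
apply: (@le_trans _ _ (ereal_sup (u @` A))).
  by apply: ereal_inf_lbound; exists A.
apply: ge_ereal_sup => _ [n An <-]; apply: (le_trans (uv n)).
by apply: ereal_sup_ubound; exists n.
Qed.

Theorem theorem2p6 (R : realType) (G : groupType)
    (Gcountable : countable [set: G]) (Gamenable : amenable R G)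
    (X Y X' Y' : gsystem R G)
    (pi : X -> Y) (pi_ext : factor_map pi)
    (pi' : X' -> Y') (pi'_ext : factor_map pi')
    (mu_ : R.-pker Y ~> X) (mu_dis : disintegration pi mu_)
    (mu'_ : R.-pker Y' ~> X') (mu'_dis : disintegration pi' mu'_)
    (phibar : X -> X') (phibar_iso : system_iso phibar)
    (phi : Y -> Y') (phi_factor : factor_map phi)
    (comm : {ae sys_meas X, forall x, pi' (phibar x) = phi (pi x)})
    (U : nat -> R) (U_rate : rate_function U)
    (F : nat -> {fset G}) (F_folner : folner_seq R F) :
  (slow_entropy U F mu_ <= slow_entropy U F mu'_)%E.
Proof.
have [phibar_factor [psi [mpsi psiK _]]] := phibar_iso.
apply: ge_ereal_sup => _ [P _ <-].
apply: (@le_trans _ _ (slow_entropy_part (pullback_partition mpsi P) U F mu'_));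
  last by apply: ereal_sup_ubound; exists (pullback_partition mpsi P).
apply: ge_ereal_sup => _ [e /= e0 <-].
(* The cap at 1 keeps 1 - d, and with it 1 - d^2 / 2, nonnegative. *)
pose d := Order.min e 1.
have d0 : 0 < d by rewrite lt_min e0 ltr01.
apply: (@le_trans _ _ (limn_esup (fun n =>
  relcov (pullback_partition mpsi P) mu'_ (F n) (d ^+ 2 / 2) *
    ((U #|` F n|)^-1)%:E)%E)); last first.
  by apply: ereal_sup_ubound; exists (d ^+ 2 / 2) => //=; rewrite divr_gt0 ?exprn_gt0.
apply: le_limn_esup => n; apply: lee_wpmul2r.
  by rewrite lee_fin invr_ge0 ltW //; case: U_rate.
have d1 : d <= 1 by rewrite ge_min lexx orbT.
have de : d <= e by rewrite ge_min lexx.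
exact: (relcov_le_base_factor pi_ext pi'_ext mu_dis mu'_dis phibar_factor mpsi
  psiK phi_factor).
Qed.
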